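(* Let $\mathbf f^{[\nu]}\in\mathcal C^2$ for $\nu=1,\dots,N$ and let $\mathbf A,\mathbf b,\mathbf c$ describe an explicit $s$-stage Runge--Kutta method of order at least $1$. The corresponding MPRK scheme (see context) is of order at least $1$ if and only if $$\sigma_\mu=y_\mu^n+\mathcal O(\Delta t)\quad\text{as }\Delta t\to0,\qquad \mu=1,\dots,N.$$
   Context: Conservative autonomous production-destruction system (PDS): $y_k'=\sum_{\nu=1}^N\bigl(p_{k\nu}(\mathbf y)-d_{k\nu}(\mathbf y)\bigr)$, $k=1,\dots,N$, with positive initial data, where $p_{k\nu},d_{k\nu}\ge0$ for $\mathbf y\ge\mathbf 0$, $p_{k\nu}=d_{\nu k}$ and $p_{kk}=d_{kk}=0$. It is written as $\mathbf y'=\mathbf f(\mathbf y)=\sum_{\nu=1}^N\mathbf f^{[\nu]}(\mathbf y)$ with $f^{[\nu]}_k=p_{k\nu}$ for $k\ne\nu$ and $f^{[k]}_k=-\sum_{\mu=1}^N d_{k\mu}$. Standing assumptions: each $\mathbf f^{[\nu]}$ is Lipschitz continuous; the Runge--Kutta coefficients satisfy $\mathbf A,\mathbf b\ge\mathbf 0$ and $\sum_{j}a_{ij}=c_i$. MPRK (modified Patankar--Runge--Kutta) scheme: for $k=1,\dots,N$, $$y_k^{(i)}=y_k^n+\Delta t\sum_{j=1}^{i-1}a_{ij}\sum_{\nu=1}^N\Bigl(p_{k\nu}(\mathbf y^{(j)})\frac{y_\nu^{(i)}}{\pi_\nu^{(i)}}-d_{k\nu}(\mathbf y^{(j)})\frac{y_k^{(i)}}{\pi_k^{(i)}}\Bigr),\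 i=1,\dots,s,$$ $$y_k^{n+1}=y_k^n+\Delta t\sum_{j=1}^{s}b_{j}\sum_{\nu=1}^N\Bigl(p_{k\nu}(\mathbf y^{(j)})\frac{y_\nu^{n+1}}{\sigma_\nu}-d_{k\nu}(\mathbf y^{(j)})\frac{y_k^{n+1}}{\sigma_k}\Bigr).$$ The Patankar-weight denominators $\pi_\nu^{(i)}=\pi_\nu^{(i)}(\mathbf y^n,\mathbf y^{(1)},\dots,\mathbf y^{(i-1)})$ and $\sigma_\nu=\sigma_\nu(\mathbf y^n,\mathbf y^{(1)},\dots,\mathbf y^{(s)})$ are positive for every $\Delta t\ge0$, continuous, and independent of $\mathbf y^{(i)}$ and $\mathbf y^{n+1}$, respectively. Here $\mathbf y^n>\mathbf 0$. Order: the method is of order at least $p$ if, starting from exact data $\mathbf y^n=\mathbf y(t_n)$, one step satisfies $\mathbf y^{n+1}-\mathbf y(t_n+\Delta t)=\mathcal O(\Delta t^{p+1})$ as $\Delta t\to0$. As usual for order conditions, the equivalence is understood for arbitrary right-hand sides of the stated class (elementary differentials regarded as linearly independent).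
   Formalization: Assumes N ≥ 2 (for N = 1 every scheme is exact and σ is arbitrary); the ''only if'' direction also assumes σ satisfies a Lipschitz estimate in the stages at (yⁿ,…,yⁿ), as it fails for merely continuous σ; ''if'' holds for all continuous σ. *)

(* Defs.v *)
From HB Require Import structures.
From mathcomp Require Export all_boot all_order all_algebra.
From mathcomp Require Export all_classical all_reals all_analysis.

Set Implicit Arguments.
Unset Strict Implicit.
Unset Printing Implicit Defensive.

Export Order.TTheory GRing.Theory Num.Theory.
Export numFieldNormedType.Exports.

Global Open Scope classical_set_scope.
Global Open Scope ring_scope.

Definition mx_gt0 {R : realType} {m n : nat} (M : 'M[R]_(m, n)) : Prop :=
  forall i j, 0 < M i j.

Definition mx_ge0 {R : realType} {m n : nat} (M : 'M[R]_(m, n)) : Prop :=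
  forall i j, 0 <= M i j.

(* The class C^k on U, by continuous partial derivatives; only meaningful for
   U open, since the derivatives are the two-sided ones. *)
Fixpoint Ck_on {R : realType} {m n : nat} (k : nat) (U : set 'rV[R]_m)
    (f : 'rV[R]_m -> 'rV[R]_n) : Prop :=
  match k with
  | 0 => forall x, U x -> {for x, continuous f}
  | k'.+1 =>
      (forall i x, U x -> derivable f x (delta_mx 0 i)) /\
      (forall i, Ck_on k' U (fun x => 'D_(delta_mx 0 i) f x))
  end.

Definition solves_near {R : realType} {m : nat} (f : 'rV[R]_m -> 'rV[R]_m)
    (t0 : R) (y : R -> 'rV[R]_m) : Prop :=
  \forall t \near t0, is_derive t (1 : R) y (f (y t)).

(* ** Runge-Kutta methods *)

Definition explicit_rk {R : realType} {s : nat} (A : 'M[R]_s) : Prop :=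
  forall i j : 'I_s, (i <= j)%N -> A i j = 0.

(* Row i of Y is the i-th stage vector. *)
Definition rk_step {R : realType} {s m : nat} (A : 'M[R]_s) (b : 'rV[R]_s)
    (f : 'rV[R]_m -> 'rV[R]_m) (h : R) (yn : 'rV[R]_m)
    (Y : 'M[R]_(s, m)) (y1 : 'rV[R]_m) : Prop :=
  (forall i, row i Y = yn + h *: \sum_j A i j *: f (row j Y)) /\
  y1 = yn + h *: \sum_j b 0 j *: f (row j Y).

Definition rk_order_at_least {R : realType} {s : nat} (p : nat)
    (A : 'M[R]_s) (b : 'rV[R]_s) : Prop :=
  forall (m : nat) (f : 'rV[R]_m -> 'rV[R]_m), Ck_on p.+1 setT f ->
  forall (t0 : R) (y : R -> 'rV[R]_m), solves_near f t0 y ->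
  forall (Y : R -> 'M[R]_(s, m)) (y1 : R -> 'rV[R]_m),
    (forall h : R, 0 <= h -> rk_step A b f h (y t0) (Y h) (y1 h)) ->
    (fun h : R => y1 h - y (t0 + h)) =O_ ((0 : R)^'+) (fun h : R => h ^+ p.+1).

(* ** Production-destruction systems *)

Record pds (R : realType) (N : nat) := PDS {
  prod_term : 'I_N -> 'I_N -> 'rV[R]_N -> R;
  dest_term : 'I_N -> 'I_N -> 'rV[R]_N -> R }.

Definition conservative_pds {R : realType} {N : nat} (P : pds R N) : Prop :=
  forall y, mx_ge0 y -> forall k nu,
    [/\ 0 <= prod_term P k nu y, 0 <= dest_term P k nu y,
        prod_term P k nu y = dest_term P nu k y,
        prod_term P k k y = 0 & dest_term P k k y = 0].

Definition pds_rhs {R : realType} {N : nat} (P : pds R N)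
    (y : 'rV[R]_N) : 'rV[R]_N :=
  \row_k \sum_nu (prod_term P k nu y - dest_term P k nu y).

(* The summand f^[nu] of the splitting f = \sum_nu f^[nu]. *)
Definition pds_split {R : realType} {N : nat} (P : pds R N) (nu : 'I_N)
    (y : 'rV[R]_N) : 'rV[R]_N :=
  \row_k (if k == nu then - \sum_mu dest_term P k mu y else prod_term P k nu y).

(* The terms are only constrained on the state space {y >= 0}; differentiability
   is asked for in its interior, where solutions and stages live. *)
Definition admissible_pds {R : realType} {N : nat} (k : nat)
    (P : pds R N) : Prop :=
  [/\ conservative_pds P,
      forall nu, [lipschitz pds_split P nu y | y in [set y | mx_ge0 y]]
    & forall nu, Ck_on k [set y | mx_gt0 y] (pds_split P nu)].

(* ** Modified Patankar-Runge-Kutta schemes *)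

(* pi i yn Y and sigma yn Y are the row vectors of Patankar-weight denominators
   for stage i and for the update; row j of Y is the stage y^(j). *)
Record patankar_weights {R : realType} {s N : nat}
    (pi : 'I_s -> 'rV[R]_N -> 'M[R]_(s, N) -> 'rV[R]_N)
    (sigma : 'rV[R]_N -> 'M[R]_(s, N) -> 'rV[R]_N) : Prop := PatankarWeights {
  pw_explicit : forall (i : 'I_s) yn Y Z,
    (forall j : 'I_s, (j < i)%N -> row j Y = row j Z) -> pi i yn Y = pi i yn Z;
  pw_pi_gt0 : forall i yn Y, mx_gt0 yn -> mx_gt0 Y -> mx_gt0 (pi i yn Y);
  pw_sigma_gt0 : forall yn Y, mx_gt0 yn -> mx_gt0 Y -> mx_gt0 (sigma yn Y);
  pw_pi_continuous : forall i yn Y, mx_gt0 yn -> mx_gt0 Y ->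
    {for (yn, Y), continuous
       (fun z : 'rV[R]_N * 'M[R]_(s, N) => pi i z.1 z.2)};
  pw_sigma_continuous : forall yn Y, mx_gt0 yn -> mx_gt0 Y ->
    {for (yn, Y), continuous
       (fun z : 'rV[R]_N * 'M[R]_(s, N) => sigma z.1 z.2)} }.

Definition mprk_stages {R : realType} {s N : nat} (A : 'M[R]_s)
    (pi : 'I_s -> 'rV[R]_N -> 'M[R]_(s, N) -> 'rV[R]_N)
    (P : pds R N) (h : R) (yn : 'rV[R]_N) (Y : 'M[R]_(s, N)) : Prop :=
  forall (i : 'I_s) (k : 'I_N),
    Y i k = yn 0 k + h * \sum_(j < s | (j < i)%N) A i j * \sum_nu
      (prod_term P k nu (row j Y) * (Y i nu / pi i yn Y 0 nu)
       - dest_term P k nu (row j Y) * (Y i k / pi i yn Y 0 k)).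

Definition mprk_update {R : realType} {s N : nat} (b : 'rV[R]_s)
    (sigma : 'rV[R]_N -> 'M[R]_(s, N) -> 'rV[R]_N)
    (P : pds R N) (h : R) (yn : 'rV[R]_N) (Y : 'M[R]_(s, N))
    (y1 : 'rV[R]_N) : Prop :=
  forall k : 'I_N,
    y1 0 k = yn 0 k + h * \sum_(j < s) b 0 j * \sum_nu
      (prod_term P k nu (row j Y) * (y1 0 nu / sigma yn Y 0 nu)
       - dest_term P k nu (row j Y) * (y1 0 k / sigma yn Y 0 k)).

Definition mprk_order_at_least {R : realType} {s N : nat} (p : nat)
    (A : 'M[R]_s) (b : 'rV[R]_s)
    (pi : 'I_s -> 'rV[R]_N -> 'M[R]_(s, N) -> 'rV[R]_N)
    (sigma : 'rV[R]_N -> 'M[R]_(s, N) -> 'rV[R]_N) : Prop :=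
  forall P : pds R N, admissible_pds p.+1 P ->
  forall (t0 : R) (y : R -> 'rV[R]_N),
    solves_near (pds_rhs P) t0 y -> mx_gt0 (y t0) ->
  forall (Y : R -> 'M[R]_(s, N)) (y1 : R -> 'rV[R]_N),
    (forall h : R, 0 <= h -> mprk_stages A pi P h (y t0) (Y h)) ->
    (forall h : R, 0 <= h -> mprk_update b sigma P h (y t0) (Y h) (y1 h)) ->
    (fun h : R => y1 h - y (t0 + h)) =O_ ((0 : R)^'+) (fun h : R => h ^+ p.+1).

(* sigma_mu = y^n_mu + O(h), for sigma evaluated along the stages of the scheme. *)
Definition sigma_consistent {R : realType} {s N : nat} (A : 'M[R]_s)
    (pi : 'I_s -> 'rV[R]_N -> 'M[R]_(s, N) -> 'rV[R]_N)
    (sigma : 'rV[R]_N -> 'M[R]_(s, N) -> 'rV[R]_N) : Prop :=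
  forall P : pds R N, admissible_pds 2 P ->
  forall yn, mx_gt0 yn ->
  forall Y : R -> 'M[R]_(s, N),
    (forall h : R, 0 <= h -> mprk_stages A pi P h yn (Y h)) ->
  forall mu, (fun h : R => sigma yn (Y h) 0 mu - yn 0 mu) =O_ ((0 : R)^'+)
             (fun h : R => h).

(* Every stage equal to yn, the value of the stages at h = 0. *)
Definition const_stages {R : realType} (s : nat) {N : nat}
    (yn : 'rV[R]_N) : 'M[R]_(s, N) := \matrix_(i, k) yn 0 k.

(* Lipschitz estimate in the stages at the single point Y = (yn, ..., yn).
   Mere continuity of sigma does not allow one to pass from order 1 to an O(h)
   bound: N = 2, b = (1, 0, 0), a_21 = a_31 = 1, a_32 = 0, pi^(2) = yn,
   pi^(3) = (yn_1, 2 yn_2).  With z_i = y^(i)_2 - yn_2, d = d_12(yn) and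
   p = p_12(yn), one has Q := 2 (z_3 - z_2) = h p + O(h^2) and
   D := 2 z_3 - z_2 = h d + O(h^2).  Taking, near the diagonal,
   sigma_1 = yn_1 / (1 + Q / |z|^(1/2)) and sigma_2 = yn_2 / (1 + D / |z|^(1/2)),
   the defect is h (d Q - p D) / |z|^(1/2) + O(h^2) = O(h^2) for every system,
   while sigma - yn is of exact size h^(1/2) as soon as (d, p) <> 0. *)
Definition sigma_lipschitz_at_diag {R : realType} {s N : nat}
    (sigma : 'rV[R]_N -> 'M[R]_(s, N) -> 'rV[R]_N) : Prop :=
  forall yn, mx_gt0 yn ->
    (fun Y : 'M[R]_(s, N) => sigma yn Y - sigma yn (const_stages s yn))
      =O_ (const_stages s yn)
    (fun Y : 'M[R]_(s, N) => Y - const_stages s yn).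

(* Main.v *)
Require Import Defs.
From mathcomp Require Import ring lra.

(**
Write one step of the scheme as y1 = yn + h F(h), where F is the weighted sum
of the production and destruction terms at the stages, each multiplied by a
ratio y1_nu / sigma_nu.  The exact solution is yn + h f(yn) + O(h^2)
([pds_solution_expansion]), so order 1 means F(h) = f(yn) + O(h).

Everything rests on a priori control of the linear systems that define the
stages and the update.  Each of them reads y = yn + B y, where B has
nonnegative off-diagonal entries and vanishing column sums ([exchange_mx]):
mass is only moved between constituents.  Hence the solution exists, is
positive, and has the same total mass as yn, so it is bounded uniformly in h
([exchange_gt0], [exchange_solve], [mprk_update_le]).  By induction on the
stages, with the weights converging to positive limits by continuity, every
stage is yn + O(h) ([mprk_stages_bigO]).

Sufficiency.  If sigma = yn + O(h), the ratios y1_nu / sigma_nu are 1 + O(h),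
and the production and destruction terms at the stages are their values at yn
up to O(h) by the Lipschitz condition.  Thus F(h) = (\sum_j b_j) f(yn) + O(h)
([mprk_update_expansion]), and \sum_j b_j = 1 because the Runge-Kutta method
has order 1 ([rk_order1_sum_weights]).

Necessity.  The number sigma_mu(yn, (yn, ..., yn)) does not depend on the
system, so it can be computed from a single convenient one: the system that
turns mu into another constituent nu at unit rate.  Its exact solutions are
affine, so no existence theorem for differential equations is involved, and
its update is y1_mu = yn_mu - h y1_mu / sigma_mu.  Comparing with yn_mu - h,
order 1 forces y1_mu / sigma_mu -> 1, that is sigma_mu(yn, (yn, ..., yn)) =
yn_mu ([order1_sigma_const]).  For an arbitrary system the Lipschitz estimate
of sigma at the diagonal, together with the stages being yn + O(h), turns this
equality into sigma = yn + O(h) ([order1_sigma_consistent]).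
*)

Set Implicit Arguments.
Unset Strict Implicit.
Unset Printing Implicit Defensive.

Local Notation "f =O(h^ n )" := (f =O_ ((0 : _)^'+) (fun h => h ^+ n))
  (at level 70, format "f  =O(h^ n )").

(** * Powers of the step size as Landau gauges *)

Section BigO_right.
Context {R : realType}.

(** On the right of 0 the gauge is positive, so its norm can be dropped. *)
Lemma bigO_powP {V : normedModType R} n (f : R -> V) : f =O(h^n) <->
  exists2 C, 0 < C & \forall h \near (0 : R)^'+, `|f h| <= C * h ^+ n.
Proof.
rewrite eqO_exP; split=> -[C C0 fC]; exists C => //; near=> h.
- have -> : h ^+ n = `|h ^+ n : R| by rewrite ger0_norm// exprn_ge0.
  by near: h.
- rewrite [X in _ * X]ger0_norm ?exprn_ge0//.
  by near: h.
Unshelve. all: by end_near. Qed.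

Lemma bigO_pow_bound {V : normedModType R} n C (f : R -> V) :
  (\forall h \near (0 : R)^'+, `|f h| <= C * h ^+ n) -> f =O(h^n).
Proof.
move=> fC; apply/bigO_powP; exists (`|C| + 1) => //; near=> h.
rewrite (@le_trans _ _ (C * h ^+ n))//; first by near: h.
by rewrite ler_wpM2r ?exprn_ge0// (le_trans (ler_norm C))// lerDl.
Unshelve. all: by end_near. Qed.

Lemma bigO_pow_near {V : normedModType R} n (f g : R -> V) :
  (\forall h \near (0 : R)^'+, f h = g h) -> g =O(h^n) -> f =O(h^n).
Proof.
move=> fg /bigO_powP[C _ gC]; apply: (@bigO_pow_bound _ _ C); near=> h.
by rewrite (near fg h)//; near: h.
Unshelve. all: by end_near. Qed.

Lemma bigO_pow_dom {V W : normedModType R} n (f : R -> V) (g : R -> W) C :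
  (\forall h \near (0 : R)^'+, `|f h| <= C * `|g h|) ->
  g =O(h^n) -> f =O(h^n).
Proof.
move=> fg /bigO_powP[D D0 gD]; apply: (@bigO_pow_bound _ _ (`|C| * D)).
near=> h; rewrite (@le_trans _ _ (C * `|g h|))//; first by near: h.
rewrite -mulrA (@le_trans _ _ (`|C| * `|g h|))//.
  by rewrite ler_wpM2r// ler_norm.
by rewrite ler_wpM2l//; near: h.
Unshelve. all: by end_near. Qed.

Lemma bigO_powD {V : normedModType R} n (f g : R -> V) :
  f =O(h^n) -> g =O(h^n) -> (fun h => f h + g h) =O(h^n).
Proof. exact: add2O. Qed.

Lemma bigO_powN {V : normedModType R} n (f : R -> V) :
  f =O(h^n) -> (fun h => - f h) =O(h^n).
Proof. exact: oppfO. Qed.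

Lemma bigO_powB {V : normedModType R} n (f g : R -> V) :
  f =O(h^n) -> g =O(h^n) -> (fun h => f h - g h) =O(h^n).
Proof. by move=> fO /bigO_powN; apply: bigO_powD. Qed.

Lemma bigO_pow_sum {V : normedModType R} n (I : finType) (f : I -> R -> V) :
  (forall i, f i =O(h^n)) -> (fun h => \sum_i f i h) =O(h^n).
Proof.
move=> fO; elim: (index_enum I) => [|i r IH].
  by apply: (@bigO_pow_bound _ _ 0); near=> h; rewrite big_nil normr0 mul0r.
apply: (@bigO_pow_near _ _ _ (fun h => f i h + \sum_(j <- r) f j h)).
  by near=> h; rewrite big_cons.
exact: bigO_powD.
Unshelve. all: by end_near. Qed.

Lemma bigO_powM m n (f g : R -> R) :
  f =O(h^m) -> g =O(h^n) -> (fun h => f h * g h) =O(h^(m + n)).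
Proof.
move=> /bigO_powP[C C0 fC] /bigO_powP[D D0 gD].
apply: (@bigO_pow_bound _ _ (C * D)); near=> h.
by rewrite normrM exprD mulrACA ler_pM//; near: h.
Unshelve. all: by end_near. Qed.

Lemma bigO_pow_le {V : normedModType R} m n (f : R -> V) :
  (n <= m)%N -> f =O(h^m) -> f =O(h^n).
Proof.
move=> nm /bigO_powP[C C0 fC]; apply: (@bigO_pow_bound _ _ C); near=> h.
rewrite (@le_trans _ _ (C * h ^+ m))//; first by near: h.
rewrite ler_wpM2l ?(ltW C0)// ler_wiXn2l//.
by near: h; apply: nbhs_right_le.
Unshelve. all: by end_near. Qed.

Lemma bigO_pow_id : (fun h : R => h) =O(h^1).
Proof. exact: idO. Qed.

Lemma cvg_bigO_pow0 {V : normedModType R} (f : R -> V) (l : V) :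
  f @ (0 : R)^'+ --> l -> f =O(h^0).
Proof.
move=> /cvgrPdist_lt/(_ 1 ltr01) fl; apply: (@bigO_pow_bound _ _ (`|l| + 1)).
near=> h; rewrite expr0 mulr1 -[f h](subKr l) (le_trans (ler_normB _ _))//.
by rewrite lerD2l ltW//; near: h.
Unshelve. all: by end_near. Qed.

Lemma bigO_pow_cst {V : normedModType R} (c : V) :
  (fun _ : R => c) =O(h^0).
Proof. by apply: (@cvg_bigO_pow0 _ _ c); exact: cvg_cst. Qed.

Lemma bigO_pow_cvg {V : normedModType R} (f : R -> V) (l : V) :
  (fun h => f h - l) =O(h^1) -> f @ (0 : R)^'+ --> l.
Proof.
move=> /bigO_powP[C C0 fC]; apply/cvgrPdist_le => e e0; near=> h.
rewrite distrC (@le_trans _ _ (C * h))//; first by rewrite -[h]expr1; near: h.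
rewrite -ler_pdivlMl// mulrC; near: h; apply: nbhs_right_le.
by rewrite divr_gt0.
Unshelve. all: by end_near. Qed.

Lemma bigO_pow_div n (g : R -> R) :
  (fun h => h * g h) =O(h^n.+1) -> g =O(h^n).
Proof.
move=> /bigO_powP[C C0 gC]; apply: (@bigO_pow_bound _ _ C); near=> h.
have h0 : 0 < h by [].
rewrite -(ler_pM2l h0) mulrCA -exprS -[X in X * _](gtr0_norm h0) -normrM.
by near: h.
Unshelve. all: by end_near. Qed.

(** The matrix norm is the maximum of finitely many entries, so the sum of the
    entrywise constants serves as a common one. *)
Lemma bigO_pow_mx m n r (f : R -> 'M[R]_(m, n)) :
  (forall i j, (fun h => f h i j) =O(h^r)) -> f =O(h^r).
Proof.
move=> fO.
pose fC i j := cid2 ((bigO_powP r _).1 (fO i j)); pose D i j := s2val (fC i j).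
apply: (@bigO_pow_bound _ _ (\sum_i \sum_j D i j)); near=> h.
have fD i j : `|f h i j| <= D i j * h ^+ r.
  move: i j; near: h; apply: filter_forall => i; apply: filter_forall => j.
  exact: (s2valP' (fC i j)).
have D0 i j : 0 <= D i j by rewrite ltW//; exact: (s2valP (fC i j)).
rewrite /Num.Def.normr/= mx_normrE; apply/bigmax_leP; split.
  by rewrite mulr_ge0 ?exprn_ge0// sumr_ge0// => i _; rewrite sumr_ge0.
move=> [i j] _ /=; apply: (le_trans (fD i j)); rewrite ler_wpM2r ?exprn_ge0//.
rewrite (bigD1 i)//= (bigD1 j)//= -addrA lerDl addr_ge0//.
  by rewrite sumr_ge0.
by rewrite sumr_ge0// => k _; rewrite sumr_ge0.
Unshelve. all: by end_near. Qed.

Lemma mx_coord_le m n (M : 'M[R]_(m, n)) i j : `|M i j| <= `|M|.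
Proof.
rewrite [leRHS]/Num.Def.normr/= mx_normrE.
exact: (@le_bigmax _ _ _ _ (fun ij : 'I_m * 'I_n => `|M ij.1 ij.2|) (i, j)).
Qed.

Lemma bigO_pow_coord m n r (f : R -> 'M[R]_(m, n)) i j :
  f =O(h^r) -> (fun h => f h i j) =O(h^r).
Proof.
apply: (@bigO_pow_dom _ _ _ _ _ 1); near=> h.
by rewrite mul1r mx_coord_le.
Unshelve. all: by end_near. Qed.
End BigO_right.

(** * Linear systems that exchange mass *)

Section Exchange.
Context {R : realType} {N : nat}.
Implicit Types (B : 'M[R]_N) (u v y : 'rV[R]_N).

(** The matrices B such that B y moves the contents of y between the
    constituents without creating or losing any: 1 - B is then an M-matrix. *)
Definition exchange_mx B : Prop :=
  (forall k nu, k != nu -> 0 <= B k nu) /\ (forall nu, \sum_k B k nu = 0).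

(** Sum the inequalities over the set S where y is negative.  A column nu
    outside S contributes only off-diagonal entries times y_nu >= 0; a column
    nu in S contributes (minus the off-diagonal entries leaving S) times
    y_nu < 0.  So the sum of y over S is nonnegative, and S is empty. *)
Lemma exchange_ge0 B y : exchange_mx B ->
  (forall k, \sum_nu B k nu * y 0 nu <= y 0 k) -> mx_ge0 y.
Proof.
move=> [B0 B1] By i k0; rewrite ord1 leNgt; apply/negP => yk0.
have : \sum_(k | y 0 k < 0) y 0 k < 0.
  rewrite (bigD1 k0)//= -[ltRHS](addr0 0) ltr_leD//.
  by apply: sumr_le0 => k /andP[/ltW].
apply/negP; rewrite -leNgt.
apply: le_trans (ler_sum _ (fun k _ => By k)).
rewrite exchange_big/= sumr_ge0// => nu _; rewrite -mulr_suml.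
have [ynu|ynu] := ltP (y 0 nu) 0; last first.
  rewrite mulr_ge0// sumr_ge0// => k yk; apply: B0.
  by apply: contraTneq yk => ->; rewrite -leNgt.
rewrite mulr_le0 ?(ltW ynu)//.
have := B1 nu; rewrite (bigID (fun k => y 0 k < 0))/= => /eqP.
rewrite addr_eq0 => /eqP ->; rewrite oppr_le0 sumr_ge0// => k yk.
by apply: B0; apply: contraNneq yk => ->.
Qed.

(** If y_k = 0, row k says that a sum of nonnegative terms is negative. *)
Lemma exchange_gt0 B y : exchange_mx B ->
  (forall k, \sum_nu B k nu * y 0 nu < y 0 k) -> mx_gt0 y.
Proof.
move=> BE By.
have y0 : mx_ge0 y by apply: (exchange_ge0 BE) => k; exact/ltW.
move=> i k; rewrite ord1 lt_neqAle y0 andbT eq_sym.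
apply: contraTneq (By k) => yk; rewrite yk -leNgt sumr_ge0// => nu _.
have [<-|kn] := eqVneq k nu; first by rewrite yk mulr0.
by rewrite mulr_ge0// BE.1.
Qed.

(** Positivity applied to y and - y makes 1 - B injective. *)
Lemma exchange_solve B v : exchange_mx B ->
  exists y, forall k, y 0 k = v 0 k + \sum_nu B k nu * y 0 nu.
Proof.
move=> BE.
have yE y k : (y *m (1%:M - B)^T) 0 k = y 0 k - \sum_nu B k nu * y 0 nu.
  rewrite linearB/= trmx1 mulmxBr mulmx1 !mxE; congr (_ - _).
  by apply: eq_bigr => nu _; rewrite mxE mulrC.
have inj y : y *m (1%:M - B)^T = 0 -> mx_ge0 y.
  move=> y0; apply: (exchange_ge0 BE) => k.
  by rewrite -subr_ge0 -yE y0 mxE.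
have U : (1%:M - B)^T \in unitmx.
  rewrite -row_free_unit -kermx_eq0; apply/rowV0P => y /sub_kermxP y0.
  apply/rowP => k; rewrite mxE; apply: le_anti.
  rewrite inj// andbT -oppr_ge0; have := inj (- y) _ 0 k; rewrite mxE; apply.
  by rewrite mulNmx y0 oppr0.
exists (v *m invmx (1%:M - B)^T) => k.
by apply/eqP; rewrite -subr_eq -yE mulmxKV.
Qed.
End Exchange.

(** * Solvability and positivity of Patankar-type systems *)

Section Patankar_system.
Context {R : realType} {s N : nat}.
Variables (P : pds R N) (cP : conservative_pds P).
Implicit Types (w : 'rV[R]_s) (yn y : 'rV[R]_N) (Y : 'M[R]_(s, N)).
Implicit Types (tau : 'rV[R]_N -> 'M[R]_(s, N) -> 'rV[R]_N).

Lemma row_gt0 Y j : mx_gt0 Y -> mx_gt0 (row j Y).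
Proof. by move=> Y0 i k; rewrite mxE. Qed.

Lemma mx_gt0W m n (M : 'M[R]_(m, n)) : mx_gt0 M -> mx_ge0 M.
Proof. by move=> M0 i j; apply/ltW. Qed.

(** The matrix B for which a Patankar-type update reads y = yn + B y: what is
    produced from nu enters row k of column nu, what is destroyed in k leaves
    through the diagonal. *)
Definition update_mx w h Y (d : 'rV[R]_N) : 'M[R]_N :=
  \matrix_(k, nu) (h * \sum_j w 0 j * (prod_term P k nu (row j Y) / d 0 nu
    - (k == nu)%:R * \sum_mu dest_term P k mu (row j Y) / d 0 k)).

Lemma mprk_updateE w tau h yn Y y : mprk_update w tau P h yn Y y <->
  forall k, y 0 k = yn 0 k + \sum_nu update_mx w h Y (tau yn Y) k nu * y 0 nu.
Proof.
suff E k : \sum_nu update_mx w h Y (tau yn Y) k nu * y 0 nu =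
    h * \sum_(j < s) w 0 j * \sum_nu
      (prod_term P k nu (row j Y) * (y 0 nu / tau yn Y 0 nu)
       - dest_term P k nu (row j Y) * (y 0 k / tau yn Y 0 k)).
  by split=> H k; have := H k; rewrite E.
under eq_bigr do rewrite mxE -mulrA mulr_suml.
rewrite -mulr_sumr; congr (_ * _).
rewrite exchange_big/=; apply: eq_bigr => j _.
under eq_bigr do rewrite -mulrA.
rewrite -mulr_sumr; congr (_ * _).
under [LHS]eq_bigr do rewrite mulrBl.
rewrite !sumrB; congr (_ - _).
  by apply: eq_bigr => nu _; rewrite mulrAC -mulrA.
rewrite [LHS](bigD1 k)//= [X in _ + X = _]big1 ?addr0 => [|nu]; last first.
  by rewrite eq_sym => /negbTE ->; rewrite !mul0r.
rewrite eqxx mul1r mulr_suml.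
by apply: eq_bigr => nu _; rewrite mulrAC -mulrA.
Qed.

(** The column sums vanish because what is destroyed in nu is what the others
    produce from nu. *)
Lemma exchange_update_mx w h Y (d : 'rV[R]_N) : 0 <= h -> mx_ge0 w ->
  mx_gt0 Y -> mx_gt0 d -> exchange_mx (update_mx w h Y d).
Proof.
move=> h0 w0 Y0 d0; have Yge j := mx_gt0W (row_gt0 j Y0); split=> [k nu kn|nu].
  rewrite mxE mulr_ge0// sumr_ge0// => j _; rewrite mulr_ge0//.
  rewrite (negbTE kn) mul0r subr0 divr_ge0 ?(ltW (d0 _ _))//.
  by case: (cP (Yge j) k nu).
under eq_bigr do rewrite mxE.
rewrite -mulr_sumr exchange_big/= big1 ?mulr0// => j _.
rewrite -mulr_sumr sumrB [X in _ - X](bigD1 nu)//=.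
rewrite [X in _ - (_ + X)]big1; last first.
  by move=> k /negbTE ->; rewrite mul0r.
rewrite eqxx mul1r addr0; apply/eqP; rewrite mulf_eq0 subr_eq0.
apply/orP; right.
by apply/eqP; apply: eq_bigr => k _; case: (cP (Yge j) k nu) => _ _ ->.
Qed.

Lemma mprk_update_gt0 w tau h yn Y y : 0 <= h -> mx_ge0 w ->
  mx_gt0 yn -> mx_gt0 Y -> mx_gt0 (tau yn Y) ->
  mprk_update w tau P h yn Y y -> mx_gt0 y.
Proof.
move=> h0 w0 yn0 Y0 t0 /mprk_updateE yE.
apply: (exchange_gt0 (exchange_update_mx h0 w0 Y0 t0)) => k.
by rewrite [ltRHS]yE ltrDr.
Qed.

(** Summing the equations gives conservation of the total mass, which bounds
    every component of a positive vector. *)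
Lemma mprk_update_le w tau h yn Y y k : 0 <= h -> mx_ge0 w ->
  mx_gt0 yn -> mx_gt0 Y -> mx_gt0 (tau yn Y) ->
  mprk_update w tau P h yn Y y -> y 0 k <= \sum_nu yn 0 nu.
Proof.
move=> h0 w0 yn0 Y0 t0 yU.
have y0 := mprk_update_gt0 h0 w0 yn0 Y0 t0 yU.
have <- : \sum_nu y 0 nu = \sum_nu yn 0 nu.
  move/mprk_updateE in yU.
  rewrite (eq_bigr _ (fun nu _ => yU nu)) big_split/= exchange_big/=.
  rewrite [X in _ + X]big1 ?addr0// => nu _; rewrite -mulr_suml.
  by rewrite (exchange_update_mx h0 w0 Y0 t0).2 mul0r.
by rewrite (bigD1 k)//= lerDl sumr_ge0// => nu _; rewrite ltW.
Qed.

Lemma mprk_update_exists w tau h yn Y : 0 <= h -> mx_ge0 w ->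
  mx_gt0 Y -> mx_gt0 (tau yn Y) ->
  exists y, mprk_update w tau P h yn Y y.
Proof.
move=> h0 w0 Y0 t0.
have [y yE] := exchange_solve yn (exchange_update_mx h0 w0 Y0 t0).
by exists y; apply/mprk_updateE.
Qed.

Variables (A : 'M[R]_s) (hA : mx_ge0 A) (hexpl : explicit_rk A).
Variable pi : 'I_s -> 'rV[R]_N -> 'M[R]_(s, N) -> 'rV[R]_N.
Hypothesis pi_expl : forall (i : 'I_s) yn Y Z,
  (forall j : 'I_s, (j < i)%N -> row j Y = row j Z) -> pi i yn Y = pi i yn Z.
Hypothesis pi_gt0 : forall i yn Y, mx_gt0 yn -> mx_gt0 Y -> mx_gt0 (pi i yn Y).

(** Since A is strictly lower triangular, a stage is itself an update, with
    the weights of its row of A.  Stages and final update can thus be treated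
    by the same lemmas. *)
Lemma mprk_stagesE h yn Y : mprk_stages A pi P h yn Y <->
  forall i, mprk_update (row i A) (pi i) P h yn Y (row i Y).
Proof.
have E i k : \sum_(j < s) row i A 0 j * \sum_nu
      (prod_term P k nu (row j Y) * (row i Y 0 nu / pi i yn Y 0 nu)
       - dest_term P k nu (row j Y) * (row i Y 0 k / pi i yn Y 0 k)) =
    \sum_(j < s | (j < i)%N) A i j * \sum_nu
      (prod_term P k nu (row j Y) * (Y i nu / pi i yn Y 0 nu)
       - dest_term P k nu (row j Y) * (Y i k / pi i yn Y 0 k)).
  rewrite [RHS]big_mkcond; apply: eq_bigr => j _; rewrite mxE.
  have [ji|ij] := ltnP j i; last by rewrite hexpl// mul0r.
  by congr (_ * _); apply: eq_bigr => nu _; rewrite !mxE.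
by split=> H i k; have := H i k; rewrite E [row _ _ _ _]mxE.
Qed.

Lemma mprk_update_congr (i : 'I_s) h yn Y Z y :
  (forall j : 'I_s, (j < i)%N -> row j Y = row j Z) ->
  mprk_update (row i A) (pi i) P h yn Y y ->
  mprk_update (row i A) (pi i) P h yn Z y.
Proof.
move=> YZ H k; have := H k; rewrite (pi_expl yn YZ) => E.
rewrite [LHS]E; congr (_ + _ * _).
apply: eq_bigr => j _; rewrite mxE.
by have [ji|ij] := ltnP j i; [rewrite YZ|rewrite hexpl// !mul0r].
Qed.

(** The stages before i, completed by yn so as to be positive everywhere even
    when nothing is known yet about the stages from i on. *)
Definition head_stages (i : nat) yn Y : 'M[R]_(s, N) :=
  \matrix_(j, k) if (j < i)%N then Y j k else yn 0 k.

Lemma row_head_stages (i : nat) yn Y (j : 'I_s) : (j < i)%N ->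
  row j (head_stages i yn Y) = row j Y.
Proof. by move=> ji; apply/rowP => k; rewrite !mxE ji. Qed.

Lemma mprk_stage_head h yn Y i : mprk_stages A pi P h yn Y ->
  mprk_update (row i A) (pi i) P h yn (head_stages i yn Y) (row i Y).
Proof.
move=> /mprk_stagesE/(_ i); apply: mprk_update_congr => j ji.
by rewrite row_head_stages.
Qed.

Lemma head_stages_gt0 i yn Y : mx_gt0 yn ->
  (forall j : 'I_s, (j < i)%N -> mx_gt0 (row j Y)) ->
  mx_gt0 (head_stages i yn Y).
Proof.
move=> yn0 Y0 j k; rewrite mxE; case: ifP => // ji.
by have := Y0 j ji 0 k; rewrite mxE.
Qed.

Lemma row_mx_ge0 i : mx_ge0 (row i A).
Proof. by move=> j k; rewrite mxE. Qed.

Lemma mprk_stages_gt0 h yn Y : 0 <= h -> mx_gt0 yn ->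
  mprk_stages A pi P h yn Y -> mx_gt0 Y.
Proof.
move=> h0 yn0 YE.
suff H n (i : 'I_s) : (i < n)%N -> mx_gt0 (row i Y).
  by move=> i k; have := H _ i (ltnSn i) 0 k; rewrite mxE.
elim: n i => // n IH i; rewrite ltnS => lein.
have Z0 : mx_gt0 (head_stages i yn Y).
  by apply: head_stages_gt0 => // j ji; apply: IH; exact: leq_trans lein.
apply: mprk_update_gt0 (mprk_stage_head i YE) => //; first exact: row_mx_ge0.
exact: pi_gt0.
Qed.

(** The stages are solved for one after the other, starting from the constant
    family; the rows not yet solved for keep the positive value yn. *)
Lemma mprk_stages_exist h yn : 0 <= h -> mx_gt0 yn ->
  exists Y, mprk_stages A pi P h yn Y.
Proof.
move=> h0 yn0.
suff H n : exists Y, mx_gt0 Y /\ forall i : 'I_s, (i < n)%N ->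
    mprk_update (row i A) (pi i) P h yn Y (row i Y).
  by have [Y [_ YE]] := H s; exists Y; apply/mprk_stagesE => i; apply: YE.
elim: n => [|n [Y [Y0 YE]]].
  by exists (const_stages s yn); split=> // i k; rewrite mxE.
have [sn|ns] := leqP s n.
  by exists Y; split=> // i _; apply: YE; exact: leq_trans sn.
pose i := Ordinal ns.
have pi0 := pi_gt0 i yn0 Y0.
have [y yE] := mprk_update_exists (tau := pi i) (yn := yn) h0
  (@row_mx_ge0 i) Y0 pi0.
have y0 := mprk_update_gt0 h0 (@row_mx_ge0 i) yn0 Y0 pi0 yE.
pose Z : 'M[R]_(s, N) := \matrix_(j, k) if j == i then y 0 k else Y j k.
have YZ (l j : 'I_s) : (l < n.+1)%N -> (j < l)%N -> row j Y = row j Z.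
  move=> ln jl; apply/rowP => k; rewrite !mxE ifF//; apply/eqP => ji.
  by move: (leq_trans jl ln); rewrite ji ltnn.
exists Z; split=> [j k|j]; first by rewrite mxE; case: ifP.
move=> jn; apply: (mprk_update_congr (YZ _ ^~ jn)).
have [->|ji] := eqVneq j i.
  by congr (mprk_update _ _ _ _ _ _ _): yE; apply/rowP => k; rewrite !mxE eqxx.
have {}jn : (j < n)%N.
  move: jn; rewrite ltnS leq_eqVlt => /orP[/eqP jn|//].
  by case/eqP: ji; exact: val_inj.
congr (mprk_update _ _ _ _ _ _ _): (YE j jn).
by apply/rowP => k; rewrite !mxE (negbTE ji).
Qed.
End Patankar_system.

(** * Expansion of one Patankar-type update *)

Section Asymptotics.
Context {R : realType} {s N : nat}.
Variables (P : pds R N) (cP : conservative_pds P).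
Hypothesis lipP :
  forall nu, [lipschitz pds_split P nu y | y in [set y | mx_ge0 y]].

(** The off-diagonal production terms are entries of the summands of the
    splitting, and the diagonal ones vanish. *)
Lemma prod_term_lipschitz : exists2 L, 0 < L & forall k nu u v,
  mx_ge0 u -> mx_ge0 v ->
  `|prod_term P k nu u - prod_term P k nu v| <= L * `|u - v|.
Proof.
have /filter_ex[L [L0 LP]] : \forall L \near +oo_R, 0 < L /\ forall nu u v,
    mx_ge0 u -> mx_ge0 v ->
    `|pds_split P nu u - pds_split P nu v| <= L * `|u - v|.
  near=> L; split; first by near: L; exact: nbhs_pinfty_gt (num_real _).
  near: L; apply: filter_forall => nu.
  have := lipP nu; rewrite /lipschitz_on; apply: filterS => L LP u v u0 v0.
  exact: (LP (u, v)).
exists L => // k nu u v u0 v0.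
have [<-|kn] := eqVneq k nu.
  case: (cP u0 k k) (cP v0 k k) => _ _ _ -> _ [_ _ _ -> _].
  by rewrite subrr normr0 mulr_ge0// ltW.
apply: le_trans (LP nu _ _ u0 v0).
have := mx_coord_le (pds_split P nu u - pds_split P nu v) 0 k.
by rewrite !mxE (negbTE kn).
Unshelve. all: by end_near. Qed.

Lemma prod_term_bigO n (u : R -> 'rV[R]_N) v k nu :
  (\forall h \near (0 : R)^'+, mx_ge0 (u h)) -> mx_ge0 v ->
  (fun h => u h - v) =O(h^n) ->
  (fun h => prod_term P k nu (u h) - prod_term P k nu v) =O(h^n).
Proof.
move=> u0 v0; have [L _ PL] := prod_term_lipschitz.
apply: (@bigO_pow_dom _ _ _ _ _ _ L).
by apply: filterS u0 => h uh; exact: PL.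
Qed.

(** Destruction terms are transposed production terms. *)
Lemma dest_term_bigO n (u : R -> 'rV[R]_N) v k nu :
  (\forall h \near (0 : R)^'+, mx_ge0 (u h)) -> mx_ge0 v ->
  (fun h => u h - v) =O(h^n) ->
  (fun h => dest_term P k nu (u h) - dest_term P k nu v) =O(h^n).
Proof.
move=> u0 v0 uv; have := prod_term_bigO nu k u0 v0 uv.
apply: bigO_pow_near; apply: filterS u0 => h uh.
by case: (cP uh nu k) (cP v0 nu k) => _ _ -> _ _ [_ _ -> _ _].
Qed.

Lemma pds_rhs_bigO n (u : R -> 'rV[R]_N) v k :
  (\forall h \near (0 : R)^'+, mx_ge0 (u h)) -> mx_ge0 v ->
  (fun h => u h - v) =O(h^n) ->
  (fun h => pds_rhs P (u h) 0 k - pds_rhs P v 0 k) =O(h^n).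
Proof.
move=> u0 v0 uv.
apply: (@bigO_pow_near _ _ _ _ (fun h => \sum_nu
  ((prod_term P k nu (u h) - prod_term P k nu v)
   - (dest_term P k nu (u h) - dest_term P k nu v)))).
  near=> h; rewrite !mxE -sumrB; apply: eq_bigr => nu _; ring.
apply: bigO_pow_sum => nu; apply: bigO_powB; first exact: prod_term_bigO.
exact: dest_term_bigO.
Unshelve. all: by end_near. Qed.

Section Update.
Variables (w : 'rV[R]_s) (tau : 'rV[R]_N -> 'M[R]_(s, N) -> 'rV[R]_N).
Variables (yn : 'rV[R]_N) (Z : R -> 'M[R]_(s, N)) (y : R -> 'rV[R]_N).
Hypothesis w0 : mx_ge0 w.
Hypothesis yn0 : mx_gt0 yn.
Hypothesis tau0 : forall Y, mx_gt0 Y -> mx_gt0 (tau yn Y).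
Hypothesis tauc : {for (yn, const_stages s yn), continuous
       (fun z : 'rV[R]_N * 'M[R]_(s, N) => tau z.1 z.2)}.
Hypothesis Z0 : forall h, 0 <= h -> mx_gt0 (Z h).
Hypothesis ZO : (fun h => Z h - const_stages s yn) =O(h^1).
Hypothesis yE : forall h, 0 <= h -> mprk_update w tau P h yn (Z h) (y h).

Lemma const_stages_gt0 : mx_gt0 (const_stages s yn).
Proof. by move=> i k; rewrite mxE. Qed.

Lemma weight_cvg nu : (fun h => tau yn (Z h) 0 nu) @ (0 : R)^'+ -->
  tau yn (const_stages s yn) 0 nu.
Proof.
apply: (@cvg_comp _ _ _ (fun h => tau yn (Z h)) (fun v : 'rV[R]_N => v 0 nu));
  last exact: coord_continuous.
apply: (@continuous2_cvg _ _ _ _ _ _ (fun=> yn) Z tau); first exact: tauc.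
  exact: cvg_cst.
exact: (bigO_pow_cvg ZO).
Qed.

Lemma weight_inv_bigO nu : (fun h => ((tau yn (Z h) 0 nu)^-1)%R) =O(h^0).
Proof.
apply: cvg_bigO_pow0; apply: cvgV; last exact: weight_cvg.
by rewrite gt_eqF// tau0//; exact: const_stages_gt0.
Qed.

Lemma update_bounded k : (fun h => y h 0 k) =O(h^0).
Proof.
apply: (@bigO_pow_bound _ _ _ (\sum_nu yn 0 nu)); near=> h.
have h0 : 0 <= h by [].
rewrite expr0 mulr1 ger0_norm.
  exact: (mprk_update_le cP _ h0 w0 yn0 (Z0 h0) (tau0 (Z0 h0)) (yE h0)).
exact/ltW/(mprk_update_gt0 cP h0 w0 yn0 (Z0 h0) (tau0 (Z0 h0)) (yE h0)).
Unshelve. all: by end_near. Qed.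

Lemma ratio_bounded nu : (fun h => y h 0 nu / tau yn (Z h) 0 nu) =O(h^0).
Proof. exact: (bigO_powM (update_bounded nu) (weight_inv_bigO nu)). Qed.

Lemma row_stage_ge0 j : \forall h \near (0 : R)^'+, mx_ge0 (row j (Z h)).
Proof. by near=> h; apply/mx_gt0W/row_gt0/Z0. Unshelve. all: by end_near. Qed.

Lemma row_stage_bigO j : (fun h => row j (Z h) - yn) =O(h^1).
Proof.
apply: bigO_pow_mx => i k; have := bigO_pow_coord j k ZO.
by apply: bigO_pow_near; near=> h; rewrite !mxE ord1.
Unshelve. all: by end_near. Qed.

Lemma prod_bounded j k nu : (fun h => prod_term P k nu (row j (Z h))) =O(h^0).
Proof.
apply: (@bigO_pow_near _ _ _ _ (fun h => (prod_term P k nu (row j (Z h))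
  - prod_term P k nu yn) + prod_term P k nu yn)).
  by near=> h; rewrite subrK.
apply: bigO_powD (bigO_pow_cst _).
apply: (bigO_pow_le (m := 1)) => //; apply: prod_term_bigO.
- exact: row_stage_ge0.
- exact: mx_gt0W.
- exact: row_stage_bigO.
Unshelve. all: by end_near. Qed.

Lemma dest_bounded j k nu : (fun h => dest_term P k nu (row j (Z h))) =O(h^0).
Proof.
apply: bigO_pow_near (prod_bounded j nu k).
by apply: filterS (row_stage_ge0 j) => h /cP/(_ nu k)[_ _ ->].
Qed.

(** The increment is h times a sum of products of bounded factors: terms of
    the system at converging stages, and ratios of a bounded solution to
    weights with positive limits. *)
Lemma mprk_update_bigO : (fun h => y h - yn) =O(h^1).
Proof.
apply: bigO_pow_mx => i k; rewrite ord1.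
apply: (@bigO_pow_near _ _ _ _ (fun h => h * \sum_(j < s) w 0 j * \sum_nu
  (prod_term P k nu (row j (Z h)) * (y h 0 nu / tau yn (Z h) 0 nu)
   - dest_term P k nu (row j (Z h)) * (y h 0 k / tau yn (Z h) 0 k)))).
  near=> h; have h0 : 0 <= h by [].
  by rewrite mxE [X in X + _](yE h0) mxE addrAC subrr add0r.
apply: (bigO_powM (m := 1) (n := 0) (bigO_pow_id)).
apply: bigO_pow_sum => j; apply: (bigO_powM (m := 0) (n := 0) (bigO_pow_cst _)).
apply: bigO_pow_sum => nu; apply: bigO_powB.
  exact: (bigO_powM (m := 0) (n := 0) (prod_bounded _ _ _) (ratio_bounded _)).
exact: (bigO_powM (m := 0) (n := 0) (dest_bounded _ _ _) (ratio_bounded _)).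
Unshelve. all: by end_near. Qed.

Hypothesis tauO : forall nu, (fun h => tau yn (Z h) 0 nu - yn 0 nu) =O(h^1).

(** Both the solution and the weight are yn + O(h), and the weight is bounded
    away from 0. *)
Lemma ratio_bigO nu : (fun h => y h 0 nu / tau yn (Z h) 0 nu - 1) =O(h^1).
Proof.
apply: (@bigO_pow_near _ _ _ _ (fun h => ((y h - yn) 0 nu -
  (tau yn (Z h) 0 nu - yn 0 nu)) * (tau yn (Z h) 0 nu)^-1)).
  near=> h; have h0 : 0 <= h by [].
  have t0 := tau0 (Z0 h0) 0 nu.
  by rewrite !mxE; field; rewrite gt_eqF.
apply: (bigO_powM (m := 1) (n := 0)); last exact: weight_inv_bigO.
by apply: bigO_powB => //; apply: bigO_pow_coord mprk_update_bigO.
Unshelve. all: by end_near. Qed.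

(** q r - c = (q - c) r + c (r - 1): perturbing a rate q near c by a Patankar
    ratio r near 1 costs O(h). *)
Lemma flux_bigO (q r : R -> R) c : r =O(h^0) ->
  (fun h => r h - 1) =O(h^1) -> (fun h => q h - c) =O(h^1) ->
  (fun h => q h * r h - c) =O(h^1).
Proof.
move=> r0 r1 qc.
apply: (@bigO_pow_near _ _ _ _ (fun h => (q h - c) * r h + c * (r h - 1))).
  by near=> h; ring.
apply: bigO_powD; first exact: (bigO_powM (m := 1) (n := 0)).
exact: (bigO_powM (m := 0) (n := 1) (bigO_pow_cst _)).
Unshelve. all: by end_near. Qed.

(** Replacing every ratio by 1 and every stage by yn changes the increment by
    h times O(h). *)
Lemma mprk_update_expansion k :
  (fun h => y h 0 k - (yn 0 k + h * ((\sum_j w 0 j) * pds_rhs P yn 0 k)))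
  =O(h^2).
Proof.
apply: (@bigO_pow_near _ _ _ _ (fun h => h * \sum_(j < s) w 0 j * \sum_nu
  ((prod_term P k nu (row j (Z h)) * (y h 0 nu / tau yn (Z h) 0 nu)
    - prod_term P k nu yn)
  - (dest_term P k nu (row j (Z h)) * (y h 0 k / tau yn (Z h) 0 k)
    - dest_term P k nu yn)))).
  near=> h; have h0 : 0 <= h by [].
  rewrite [X in X - _](yE h0) opprD addrACA subrr add0r -mulrBr.
  rewrite mulr_suml -sumrB; congr (_ * _); apply: eq_bigr => j _.
  rewrite -mulrBr mxE -sumrB; congr (_ * _).
  by apply: eq_bigr => nu _; ring.
apply: (bigO_powM (m := 1) (n := 1) (bigO_pow_id)).
apply: bigO_pow_sum => j; apply: (bigO_powM (m := 0) (n := 1) (bigO_pow_cst _)).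
have pos : mx_ge0 yn by exact: mx_gt0W.
apply: bigO_pow_sum => nu; apply: bigO_powB; apply: flux_bigO.
- exact: ratio_bounded.
- exact: ratio_bigO.
- by apply: prod_term_bigO => //; [exact: row_stage_ge0|exact: row_stage_bigO].
- exact: ratio_bounded.
- exact: ratio_bigO.
- by apply: dest_term_bigO => //; [exact: row_stage_ge0|exact: row_stage_bigO].
Unshelve. all: by end_near. Qed.

End Update.
End Asymptotics.

(** * The stages of the scheme *)

Section Stages.
Context {R : realType} {s N : nat}.
Variables (A : 'M[R]_s) (hA : mx_ge0 A) (hexpl : explicit_rk A).
Variables (pi : 'I_s -> 'rV[R]_N -> 'M[R]_(s, N) -> 'rV[R]_N)
  (sigma : 'rV[R]_N -> 'M[R]_(s, N) -> 'rV[R]_N).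
Hypothesis hw : patankar_weights pi sigma.
Variables (P : pds R N) (cP : conservative_pds P).
Hypothesis lipP :
  forall nu, [lipschitz pds_split P nu y | y in [set y | mx_ge0 y]].

(** Induction on the stage: when the previous stages are yn + O(h), the update
    that defines the current one starts from converging data. *)
Lemma mprk_stages_bigO yn (Y : R -> 'M[R]_(s, N)) : mx_gt0 yn ->
  (forall h, 0 <= h -> mprk_stages A pi P h yn (Y h)) ->
  (fun h => Y h - const_stages s yn) =O(h^1).
Proof.
move=> yn0 YE.
have Y0 h : 0 <= h -> mx_gt0 (Y h).
  by move=> h0; apply: (mprk_stages_gt0 cP hA hexpl (pw_explicit hw)
    (pw_pi_gt0 hw) h0 yn0 (YE h h0)).
suff H n (i : 'I_s) : (i < n)%N -> (fun h => row i (Y h) - yn) =O(h^1).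
  apply: bigO_pow_mx => i k; have := bigO_pow_coord 0 k (H _ i (ltnSn i)).
  by apply: bigO_pow_near; near=> h; rewrite !mxE.
elim: n i => // n IH i; rewrite ltnS => lein.
apply: (@mprk_update_bigO _ _ _ _ cP lipP (row i A) (pi i) yn
  (fun h => head_stages i yn (Y h))).
- exact: row_mx_ge0.
- exact: yn0.
- by move=> Z Z0; apply: (pw_pi_gt0 hw).
- by apply: (pw_pi_continuous hw) => //; exact: const_stages_gt0.
- by move=> h h0; apply: head_stages_gt0 => // j _; apply/row_gt0/Y0.
- apply: bigO_pow_mx => j k; have [ji|ij] := ltnP j i.
    have := bigO_pow_coord 0 k (IH j (leq_trans ji lein)).
    by apply: bigO_pow_near; near=> h; rewrite !mxE ji.
  apply: (@bigO_pow_bound _ _ _ 0); near=> h.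
  by rewrite !mxE ltnNge ij/= subrr normr0 mul0r.
- by move=> h h0; apply: (mprk_stage_head hexpl (pw_explicit hw)); exact: YE.
Unshelve. all: by end_near. Qed.

End Stages.

(** * Expansion of the exact solution *)

Section ODE.
Context {R : realType}.

(** By the mean value theorem the remainder is h times the value of phi - c at
    an intermediate point. *)
Lemma mean_value_bigO n (g phi : R -> R) (t0 c : R) :
  (\forall t \near t0, is_derive t (1 : R) g (phi t)) ->
  (fun h => phi (t0 + h) - c) =O(h^n) ->
  (fun h => g (t0 + h) - (g t0 + h * c)) =O(h^n.+1).
Proof.
move=> /nbhs_ballP[d /= d0 dg] /bigO_powP[C C0].
rewrite near_withinE => /nbhs_ballP[e /= e0 eC].
apply: (@bigO_pow_bound _ _ _ C); near=> h.
have h0 : 0 < h by [].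
have hd : h < d by near: h; exact: nbhs_right_lt.
have he : h < e by near: h; exact: nbhs_right_lt.
have gt t : t0 <= t <= t0 + h -> is_derive t (1 : R) g (phi t).
  move=> /andP[t1 t2]; apply: dg; rewrite /ball/=.
  by rewrite distrC ger0_norm ?subr_ge0//; lra.
have [|||t /[!in_itv]/= /andP[t1 t2] gE] := @MVT R g phi t0 (t0 + h).
- by rewrite ltrDl.
- move=> t /[!in_itv]/= /andP[t1 t2]; apply: gt; lra.
- apply: derivable_within_continuous => t /[!in_itv]/= /gt gd.
  exact: ex_derive.
have -> : g (t0 + h) - (g t0 + h * c) = h * (phi t - c).
  by rewrite opprD addrA gE; ring.
rewrite normrM gtr0_norm// exprS mulrCA ler_wpM2l ?(ltW h0)//.
apply: (@le_trans _ _ (C * (t - t0) ^+ n)).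
  rewrite -[in leLHS](subrKC t0 t); apply: eC; rewrite /= ?subr_gt0//.
  by rewrite /ball/= sub0r normrN gtr0_norm ?subr_gt0//; lra.
rewrite ler_wpM2l ?(ltW C0)// lerXn2r ?nnegrE ?subr_ge0 ?(ltW t1) ?(ltW h0)//.
lra.
Unshelve. all: by end_near. Qed.

(** The mean value estimate is used twice: continuity of y bounds y', whence
    y(t0 + h) = y(t0) + O(h); the Lipschitz condition then gives
    y'(t0 + h) = y'(t0) + O(h), whence the expansion to second order. *)
Lemma pds_solution_expansion N (P : pds R N) (t0 : R) (y : R -> 'rV[R]_N) k :
  conservative_pds P ->
  (forall nu, [lipschitz pds_split P nu y | y in [set y | mx_ge0 y]]) ->
  solves_near (pds_rhs P) t0 y -> mx_gt0 (y t0) ->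
  (fun h => y (t0 + h) 0 k - (y t0 0 k + h * pds_rhs P (y t0) 0 k)) =O(h^2).
Proof.
move=> cP lipP yE y0.
have yc : (fun h => y (t0 + h)) @ (0 : R)^'+ --> y t0.
  have yt0 : {for t0, continuous y}.
    have [+ _] := nbhs_singleton yE.
    by move=> /derivable1_diffP/differentiable_continuous.
  apply: (@continuous_cvg _ _ _ _ _ (fun h => t0 + h) y t0) => //.
  rewrite -[X in _ --> X](addr0 t0); apply: cvgD; first exact: cvg_cst.
  exact: cvg_within.
have ynear : \forall h \near (0 : R)^'+, mx_ge0 (y (t0 + h)).
  have : \forall h \near (0 : R)^'+, forall i : 'I_N, 0 < y (t0 + h) 0 i.
    apply: filter_forall => i.
    have yi : (fun h => y (t0 + h) 0 i) @ (0 : R)^'+ --> y t0 0 i.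
      apply: (@cvg_comp _ _ _ (fun h => y (t0 + h))
        (fun v : 'rV[R]_N => v 0 i) _ _ _ yc).
      exact: coord_continuous.
    by apply: (cvgr_gt _ yi); exact: y0.
  by apply: filterS => h yh i j; rewrite ord1 ltW.
have yk j : \forall t \near t0,
    is_derive t (1 : R) (fun t => y t 0 j) (pds_rhs P (y t) 0 j).
  apply: filterS yE => t yt; have [yd yv] := yt.
  apply: DeriveDef; first by move/derivable_mxP : yd.
  by rewrite -yv derive_mx// mxE.
have y1 : (fun h => y (t0 + h) - y t0) =O(h^1).
  apply: bigO_pow_mx => i j; rewrite ord1.
  (* a bounded derivative is one that is 0 + O(1) *)
  have : (fun h => pds_rhs P (y (t0 + h)) 0 j - 0) =O(h^0).
    apply: (@bigO_pow_near _ _ _ _ (fun h => (pds_rhs P (y (t0 + h)) 0 j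
      - pds_rhs P (y t0) 0 j) + pds_rhs P (y t0) 0 j)).
      by near=> h; rewrite subr0 subrK.
    apply: bigO_powD (bigO_pow_cst _).
    apply: pds_rhs_bigO => //; first exact: mx_gt0W.
    apply: (@cvg_bigO_pow0 _ _ _ (y t0 - y t0)); apply: cvgB => //.
    exact: cvg_cst.
  move=> /(mean_value_bigO (yk j)); apply: bigO_pow_near.
  by near=> h; rewrite !mxE mulr0 addr0.
apply: (mean_value_bigO (yk k)).
by apply: pds_rhs_bigO => //; exact: mx_gt0W.
Unshelve. all: by end_near. Qed.
End ODE.

(** * The order condition of the underlying Runge-Kutta method *)

Lemma Ck_on_cst (R : realType) m n k (U : set 'rV[R]_m) (c : 'rV[R]_n) :
  Ck_on k U (fun=> c).
Proof.
elim: k c => [|k IH] c /=; first by move=> x _; exact: cst_continuous.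
split=> [i x _|i]; first exact: derivable_cst.
rewrite (_ : (fun x => 'D_(delta_mx 0 i) _ x) = fun=> 0); first exact: IH.
by apply/funext => x; exact: derive_cst.
Qed.

Lemma is_derive_affine (R : realType) N (a v : 'rV[R]_N) (t : R) :
  is_derive t (1 : R) (fun t : R => a + t *: v) v.
Proof.
have D i j : is_derive t (1 : R) (fun t : R => (a + t *: v) i j) (v i j).
  rewrite (_ : (fun t => _) = (fun t => a i j + t * v i j)).
    have := @is_deriveD _ _ _ (cst (a i j)) (fun t : R => t * v i j) t 1 0
      (v i j).
    rewrite add0r; apply.
    have := @is_deriveM _ _ id (cst (v i j)) t 1 1 0.
    by rewrite scaler0 add0r /GRing.scale/= mulr1; apply.
  by apply/funext => u; rewrite !mxE.
have dv : derivable (fun t : R => a + t *: v) t (1 : R).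
  by apply/derivable_mxP => i j; exact: ex_derive.
apply: DeriveDef => //; rewrite derive_mx//.
by apply/matrixP => i j; rewrite mxE derive_val.
Qed.

(** Test the method on the scalar equation y' = 1, whose numerical solution
    is h \sum_j b_j. *)
Lemma rk_order1_sum_weights (R : realType) s (A : 'M[R]_s) (b : 'rV[R]_s) :
  rk_order_at_least 1 A b -> \sum_j b 0 j = 1.
Proof.
move=> ord; pose e : 'rV[R]_1 := const_mx 1.
have := ord 1%N (fun=> e) (Ck_on_cst _ _ _) 0 (fun t => 0 + t *: e).
move=> /(_ _ (fun h => \matrix_(i, k) (h * \sum_j A i j))
  (fun h => h *: (\sum_j b 0 j *: e))) O2.
have {O2} :
    (fun h : R => h *: (\sum_j b 0 j *: e) - (0 + (0 + h) *: e)) =O(h^2).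
  apply: O2 => [|h h0]; first by near=> t; exact: is_derive_affine.
  rewrite /= scale0r addr0; split=> [i|]; last by rewrite add0r.
  rewrite add0r; apply/rowP => k; rewrite !mxE summxE.
  by congr (_ * _); apply: eq_bigr => j _; rewrite !mxE mulr1.
move=> /(bigO_pow_coord 0 0) O2.
have : (fun h : R => h * (\sum_j b 0 j - 1)) =O(h^2).
  apply: bigO_pow_near O2; near=> h.
  rewrite !mxE summxE mulrBr mulr1 !add0r mulr1.
  by congr (_ * _ - _); apply: eq_bigr => j _; rewrite !mxE mulr1.
move=> /bigO_pow_div/(bigO_pow_cvg (f := fun=> \sum_j b 0 j)) b1.
exact: (cvg_unique _ (cvg_cst _) b1).
Unshelve. all: by end_near. Qed.

(** * Order one of the scheme *)

(** Constant rates are allowed because the destruction terms need not vanish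
    where their constituent does; they make every solution affine. *)
Definition transfer_pds {R : realType} {N : nat} (mu nu : 'I_N) : pds R N :=
  {| prod_term k l _ := ((k == nu) && (l == mu))%:R;
     dest_term k l _ := ((k == mu) && (l == nu))%:R |}.

Lemma transfer_pds_admissible (R : realType) N k (mu nu : 'I_N) : mu != nu ->
  admissible_pds k (transfer_pds mu nu : pds R N).
Proof.
move=> mn; split=> [y _ i j|l|l].
- rewrite /= !ler0n andbC; split=> //.
    by case: eqP => //= ->; rewrite eq_sym (negbTE mn).
  by case: eqP => //= ->; rewrite (negbTE mn).
- rewrite /lipschitz_on; near=> M; move=> [u v] _ /=.
  by rewrite subrr normr0 mulr_ge0//; near: M; exact: nbhs_pinfty_ge.
- exact: (Ck_on_cst _ _ (pds_split (transfer_pds mu nu) l 0)).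
Unshelve. all: by end_near. Qed.

Section Order.
Context {R : realType} {s N : nat}.
Variables (A : 'M[R]_s) (b : 'rV[R]_s).
Variables (pi : 'I_s -> 'rV[R]_N -> 'M[R]_(s, N) -> 'rV[R]_N)
  (sigma : 'rV[R]_N -> 'M[R]_(s, N) -> 'rV[R]_N).
Hypotheses (hA : mx_ge0 A) (hb : mx_ge0 b) (hexpl : explicit_rk A).
Hypotheses (b1 : \sum_j b 0 j = 1) (hw : patankar_weights pi sigma).

Lemma mprk_step_exists (P : pds R N) yn : conservative_pds P -> mx_gt0 yn ->
  exists (Y : R -> 'M[R]_(s, N)) (y1 : R -> 'rV[R]_N),
    (forall h, 0 <= h -> mprk_stages A pi P h yn (Y h)) /\
    (forall h, 0 <= h -> mprk_update b sigma P h yn (Y h) (y1 h)).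
Proof.
move=> cP yn0.
suff /choice[F FE] : forall h, exists Yy : 'M[R]_(s, N) * 'rV[R]_N, 0 <= h ->
    mprk_stages A pi P h yn Yy.1 /\ mprk_update b sigma P h yn Yy.1 Yy.2.
  by exists (fun h => (F h).1), (fun h => (F h).2); split=> h /FE[].
(* for h < 0 nothing is required, and (0, 0) is a dummy value *)
move=> h; have [h0|h0] := leP 0 h; last by exists (0, 0).
have [Y YE] := mprk_stages_exist cP hA hexpl (pw_explicit hw)
  (pw_pi_gt0 hw) h0 yn0.
have Y0 := mprk_stages_gt0 cP hA hexpl (pw_explicit hw)
  (pw_pi_gt0 hw) h0 yn0 YE.
have [y yE] := mprk_update_exists cP h0 hb Y0 (pw_sigma_gt0 hw yn0 Y0).
by exists (Y, y).
Qed.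

(** The numerical and the exact solution have the same expansion up to O(h^2),
    as the weights b_j sum to 1. *)
Lemma sigma_consistent_order1 :
  sigma_consistent A pi sigma -> mprk_order_at_least 1 A b pi sigma.
Proof.
move=> sO P adP t0 y yE y0 Y y1 YE y1E; have [cP lipP _] := adP.
apply: bigO_pow_mx => i k; rewrite ord1.
have Y0 h : 0 <= h -> mx_gt0 (Y h).
  by move=> h0; apply: (mprk_stages_gt0 cP hA hexpl (pw_explicit hw)
    (pw_pi_gt0 hw) h0 y0 (YE h h0)).
have s0 Z : mx_gt0 Z -> mx_gt0 (sigma (y t0) Z) by exact: (pw_sigma_gt0 hw).
have num := @mprk_update_expansion _ _ _ _ cP lipP b sigma (y t0) Y y1 hb y0
  s0 (pw_sigma_continuous hw y0 (const_stages_gt0 y0)) Y0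
  (mprk_stages_bigO hA hexpl hw cP lipP y0 YE) y1E (sO P adP _ y0 Y YE) k.
have := bigO_powB num (pds_solution_expansion k cP lipP yE y0).
by apply: bigO_pow_near; near=> h; rewrite b1 mul1r !mxE; ring.
Unshelve. all: by end_near. Qed.

(** For the transfer of mu into nu, the numerical solution is
    yn_mu - h y1_mu / sigma_mu and the exact one is yn_mu - h, so order 1 gives
    y1_mu / sigma_mu = 1 + O(h), while y1_mu tends to yn_mu and sigma_mu to its
    value at the constant stages. *)
Lemma order1_sigma_const yn mu : (1 < N)%N -> mx_gt0 yn ->
  mprk_order_at_least 1 A b pi sigma ->
  sigma yn (const_stages s yn) 0 mu = yn 0 mu.
Proof.
move=> N1 yn0 ord.
have /card_gt0P[nu] : (0 < #|predC1 mu|)%N.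
  by rewrite cardC1 card_ord -subn1 subn_gt0.
rewrite inE/= eq_sym => mn.
pose P : pds R N := transfer_pds mu nu.
have adP : admissible_pds 2 P := transfer_pds_admissible _ 2 mn.
have [cP lipP _] := adP.
have [Y [y1 [YE y1E]]] := mprk_step_exists cP yn0.
have Y0 h : 0 <= h -> mx_gt0 (Y h).
  by move=> h0; apply: (mprk_stages_gt0 cP hA hexpl (pw_explicit hw)
    (pw_pi_gt0 hw) h0 yn0 (YE h h0)).
have rhs_mu v : pds_rhs P v 0 mu = -1.
  rewrite mxE (bigD1 nu)//= big1 => [|l /negbTE ln].
    by rewrite (negbTE mn) !eqxx/= sub0r addr0.
  by rewrite (negbTE mn) ln andbF subrr.
pose y (t : R) := yn + t *: pds_rhs P yn.
have y0 : y 0 = yn by rewrite /y scale0r addr0.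
have yE : solves_near (pds_rhs P) 0 y by near=> t; exact: is_derive_affine.
have := ord P adP 0 y yE; rewrite y0 => /(_ yn0 Y y1 YE y1E).
move=> /(bigO_pow_coord 0 mu) O2.
have YO := mprk_stages_bigO hA hexpl hw cP lipP yn0 YE.
have s0 Z : mx_gt0 Z -> mx_gt0 (sigma yn Z) by exact: (pw_sigma_gt0 hw).
have sc := pw_sigma_continuous hw yn0 (const_stages_gt0 (s := s) yn0).
have sl := weight_cvg (nu := mu) sc YO.
have y1l : (fun h => y1 h 0 mu) @ (0 : R)^'+ --> yn 0 mu.
  apply: (@bigO_pow_cvg _ _ (fun h => y1 h 0 mu)).
  have := bigO_pow_coord 0 mu (mprk_update_bigO cP lipP hb yn0 s0 sc Y0 YO y1E).
  by apply: bigO_pow_near; near=> h; rewrite !mxE.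
have : (fun h => h * (y1 h 0 mu / sigma yn (Y h) 0 mu - 1)) =O(h^2).
  have := bigO_powN O2; apply: bigO_pow_near; near=> h.
  have h0 : 0 <= h by [].
  have := rhs_mu yn; rewrite !mxE add0r => ->.
  rewrite [X in - (X - _)](y1E h h0).
  have E (j : 'I_s) : \sum_l
      (prod_term P mu l (row j (Y h)) * (y1 h 0 l / sigma yn (Y h) 0 l)
       - dest_term P mu l (row j (Y h)) * (y1 h 0 mu / sigma yn (Y h) 0 mu))
      = - (y1 h 0 mu / sigma yn (Y h) 0 mu).
    rewrite (bigD1 nu)//= big1 => [|l /negbTE ln].
      by rewrite (negbTE mn) !eqxx/= mul0r mul1r sub0r addr0.
    by rewrite (negbTE mn) ln andbF !mul0r subrr.
  rewrite (eq_bigr _ (fun j _ => congr1 ( *%R (b 0 j)) (E j))) -mulr_suml b1.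
  ring.
move=> /bigO_pow_div/bigO_pow_cvg r1.
have y1s : (fun h => y1 h 0 mu) @ (0 : R)^'+ -->
    sigma yn (const_stages s yn) 0 mu.
  (* y1_mu = (y1_mu / sigma_mu) sigma_mu, where the first factor tends to 1 *)
  pose r h := y1 h 0 mu / sigma yn (Y h) 0 mu * sigma yn (Y h) 0 mu.
  have rE : {near (0 : R)^'+, r =1 (fun h => y1 h 0 mu)}.
    by near=> h; rewrite /r divfK// gt_eqF// s0//; apply: Y0.
  rewrite -[X in _ --> X]mul1r; apply: cvg_trans (near_eq_cvg rE) _.
  exact: cvgM r1 sl.
exact: (cvg_unique _ y1s y1l).
Unshelve. all: by end_near. Qed.

Lemma order1_sigma_consistent : (1 < N)%N -> sigma_lipschitz_at_diag sigma ->
  mprk_order_at_least 1 A b pi sigma -> sigma_consistent A pi sigma.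
Proof.
move=> N1 lip ord P [cP lipP _] yn yn0 Y YE mu.
have YO := mprk_stages_bigO hA hexpl hw cP lipP yn0 YE.
have /eqO_exP[C C0 sC] := lip yn yn0.
have : (fun h => sigma yn (Y h) - sigma yn (const_stages s yn)) =O(h^1).
  apply: (bigO_pow_dom (C := C) _ YO); exact: (bigO_pow_cvg YO sC).
move=> /(bigO_pow_coord 0 mu); apply: bigO_pow_near; near=> h.
by rewrite !mxE order1_sigma_const.
Unshelve. all: by end_near. Qed.
End Order.

Theorem theorem4p11 (R : realType) (N s : nat)
    (A : 'M[R]_s) (b c : 'rV[R]_s)
    (pi : 'I_s -> 'rV[R]_N -> 'M[R]_(s, N) -> 'rV[R]_N)
    (sigma : 'rV[R]_N -> 'M[R]_(s, N) -> 'rV[R]_N)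
    (hN : (1 < N)%N)
    (hA : mx_ge0 A) (hb : mx_ge0 b)
    (hc : forall i, \sum_j A i j = c 0 i)
    (hexpl : explicit_rk A)
    (hrk : rk_order_at_least 1 A b)
    (hw : patankar_weights pi sigma) :
  (sigma_lipschitz_at_diag sigma ->
     (mprk_order_at_least 1 A b pi sigma <-> sigma_consistent A pi sigma)) /\
  (sigma_consistent A pi sigma -> mprk_order_at_least 1 A b pi sigma).
Proof.
have b1 := rk_order1_sum_weights hrk.
split=> [lip|]; last exact: sigma_consistent_order1.
by split; [exact: order1_sigma_consistent|exact: sigma_consistent_order1].
Qed.
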